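(* Every subcubic graph $G$ (maximum degree at most $3$) admits an edge-coloring with colors $\{0,1,\dots,8\}$ such that: the edges of color $0$ form a matching; for each $i\in\{1,\dots,8\}$, any two distinct edges of color $i$ are at distance at least $3$; and no vertex of degree at most $2$ in $G$ is incident with an edge of color $0$.
   Context: The distance between two edges is the distance between the corresponding vertices in the line graph of $G$ (adjacent edges are at distance $1$). Such a coloring is called a good $(1,2^8)$-packing edge-coloring. *)

(* Defs.v *)
From HB Require Import structures.
From mathcomp Require Import all_boot.

Set Implicit Arguments.
Unset Strict Implicit.
Unset Printing Implicit Defensive.

(* Graphs are finite, simple and undirected. *)
Record sgraph := SGraph {
  vertex :> finType;
  adj : rel vertex;
  adj_sym : symmetric adj;
  adj_irrefl : irreflexive adj
}.

Section Graph.
Variable G : sgraph.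

Definition degree (v : G) : nat := #|[set u | adj v u]|.

Definition subcubic : Prop := forall v : G, degree v <= 3.

(* An edge is identified with the two-element set of its endpoints. *)
Definition edge_set : {set {set G}} :=
  [set [set p.1; p.2] | p : G * G & adj p.1 p.2].

Definition edge : finType := {f : {set G} | f \in edge_set}.

Definition incident (v : G) (f : edge) : bool := v \in val f.

Definition matching (M : {set edge}) : Prop :=
  forall f g : edge, f \in M -> g \in M -> f != g ->
    [disjoint val f & val g].

Definition walk (k : nat) (x y : G) : bool :=
  [exists p : k.-tuple G, path (@adj G) x p && (last x p == y)].

Lemma walkP k x y :
  reflect (exists p, [/\ path (@adj G) x p, last x p = y & size p = k])
          (walk k x y).
Proof.
apply: (iffP existsP) => [[p /andP[pp /eqP lp]]|[p [pp lp /eqP sp]]].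
  by exists p; rewrite size_tuple.
by exists (Tuple sp); rewrite /= pp lp eqxx.
Qed.

Lemma connect_walk x y : connect (@adj G) x y -> exists k, walk k x y.
Proof.
by case/connectP=> p pp ->; exists (size p); apply/walkP; exists p.
Qed.

(* The length of a shortest walk, or None (infinity) if there is none. *)
Definition dist (x y : G) : option nat :=
  if decP (@idP (connect (@adj G) x y)) is left xy
  then Some (ex_minn (connect_walk xy)) else None.

Definition dist_ge (d : nat) (x y : G) : bool :=
  if dist x y is Some k then d <= k else true.

Lemma dist_geP d x y :
  reflect (forall p, path (@adj G) x p -> last x p = y -> d <= size p)
          (dist_ge d x y).
Proof.
rewrite /dist_ge /dist; case: decP => [xy|nxy].
  case: ex_minnP => k wk kmin.
  apply: (iffP idP) => [dk q qq lq|ge_d].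
    by apply: leq_trans dk _; apply: kmin; apply/walkP; exists q.
  by case/walkP: wk => p [pp lp <-]; apply: ge_d.
apply: ReflectT => p pp lp; by case: nxy; apply/connectP; exists p.
Qed.

Definition edge_adj (f g : edge) : bool :=
  (f != g) && ~~ [disjoint val f & val g].

Fact edge_adj_sym : symmetric edge_adj.
Proof. by move=> f g; rewrite /edge_adj eq_sym disjoint_sym. Qed.

Fact edge_adj_irrefl : irreflexive edge_adj.
Proof. by move=> f; rewrite /edge_adj eqxx. Qed.

Definition line_graph : sgraph := SGraph edge_adj_sym edge_adj_irrefl.

End Graph.

(* Main.v *)
Require Import Defs.
From mathcomp Require Import all_boot zify.
From Stdlib Require Import Classical_Prop.

Set Implicit Arguments.
Unset Strict Implicit.
Unset Printing Implicit Defensive.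

(* Induct on the number of edges. Around a vertex v of degree 1 or 2, colour
   G - v; the neighbours of v now have degree at most 2, so colour 0 is absent
   there, and after turning an edge at each neighbour into colour 0 whenever this
   is possible, the edges at v see at most seven colours.

   If all degrees are 0 or 3, colour G - C for a shortest cycle C. The edges
   leaving C can receive colour 0, since their outer ends have degree at most 2
   in G - C. (On cycles of length 3 or 4 some outer vertices may be shared; then
   each of them gets one such edge and the other ones are coloured greedily.)
   Every edge v_i v_{i+1} of C then avoids only the at most two colours A_i at the
   outer neighbour of v_i and the at most two colours A_{i+1} at that of v_{i+1},
   besides those of the four nearest edges of C. This is a colouring of the square
   of a cycle from lists of size at least 4: greedy colouring works unless all
   lists coincide and have size 4. In that case A_i and A_{i+1} are complementary
   in a fixed 4-set, so the length of C is even and an explicit pattern exists. *)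

(** * Colouring the square of a cycle from lists *)

Lemma periodic_mod (T : Type) n (h : nat -> T) :
  (forall i, h (i + n) = h i) -> forall i, h (i %% n) = h i.
Proof.
move=> hn i; rewrite [in RHS](divn_eq i n).
elim: (i %/ n) => [|k IH]; first by rewrite mul0n add0n.
by rewrite mulSn -addnA addnC hn.
Qed.

Lemma periodic_mulD (T : Type) n (h : nat -> T) :
  (forall i, h (i + n) = h i) -> forall k i, h (i + k * n) = h i.
Proof.
move=> hn k i; elim: k => [|k IH]; first by rewrite addn0.
by rewrite mulSn addnCA addnC hn.
Qed.

Lemma modn_succ n i : 0 < n ->
  i.+1 %% n = if i %% n == n.-1 then 0 else (i %% n).+1.
Proof.
move=> n0; rewrite -addn1 -modnDml addn1; have rn := ltn_pmod i n0.
case: eqP => [->|ne]; first by rewrite prednK // modnn.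
by rewrite modn_small //; lia.
Qed.

(** Position [i] stands for the cycle edge from [v i] to [v i.+1], and [A i] for the colours at the
    outer neighbour of [v i]. Colour 0 is kept off the cycle. *)
Definition avail (A : nat -> {set 'I_9}) i := ~: (ord0 |: (A i :|: A i.+1)).

Lemma card_avail (A : nat -> {set 'I_9}) i : (forall j, #|A j| <= 2) ->
  4 <= #|avail A i|.
Proof.
move=> A_le2; have := cardsC (ord0 |: (A i :|: A i.+1)).
rewrite card_ord -/(avail A i) cardsU1.
have [+ _] := leq_card_setU (A i) (A i.+1); have := A_le2 i; have := A_le2 i.+1.
case: (_ \notin _) => /=; move: #|A i| #|A i.+1| #|_ :|: _| #|avail A i|; lia.
Qed.

Lemma pick_avail (D : {set 'I_9}) (a b c : 'I_9) :
  4 <= #|D| -> exists x, [/\ x \in D, x != a, x != b & x != c].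
Proof.
move=> D4; have : 0 < #|D :\ a :\ b :\ c|.
  move: D4; rewrite (cardsD1 a D) (cardsD1 b (D :\ a)) (cardsD1 c (D :\ a :\ b)).
  by move: #|_|; do 3! case: (_ \in _) => /=; lia.
by case/card_gt0P=> x; rewrite !inE => /and4P[]; exists x.
Qed.

Section CycleListColouring.
Variable (n : nat) (A : nat -> {set 'I_9}).
Hypotheses (n_ge3 : 2 < n) (A_per : forall i, A (i + n) = A i).
Hypothesis A_le2 : forall i, #|A i| <= 2.

(** Periodic functions on [nat] replace functions on residues, so that neighbours are always reached
    by successors. *)
Definition square_colouring (f : nat -> 'I_9) :=
  [/\ forall i, f (i + n) = f i, forall i, f i \in avail A i,
      forall i, f i != f i.+1 & forall i, f i != f i.+2].

Lemma avail_per i : avail A (i + n) = avail A i.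
Proof. by rewrite /avail -addSn !A_per. Qed.

(* [a] leaves four colours at position n-1, so only the last choice, which has
   four neighbours already coloured, relies on it. *)
Lemma greedy_square_colouring a :
  a \in avail A 0 -> 4 <= #|avail A n.-1 :\ a| -> exists f, square_colouring f.
Proof.
move=> a0 a4.
have [g [g0 gP]] : exists g : nat -> 'I_9, g 0 = a /\
    forall j, [/\ g j.+1 \in avail A j.+1, g j.+1 != a, g j.+1 != g j
               & g j.+2 != g j].
  (* The pair holds the colours at positions [j.-1] and [j]. Avoiding [a] everywhere settles in
     advance the conflict between positions [n.-2] and 0. *)
  pose ok j (p : 'I_9 * 'I_9) x :=
    [&& x \in avail A j.+1, x != a, x != p.2 & x != p.1].
  pose nxt j p := odflt a [pick x | ok j p x].
  have okP j p : ok j p (nxt j p).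
    rewrite /nxt; case: pickP => // no.
    have [x [xa x1 x2 x3]] := pick_avail a p.2 p.1 (card_avail j.+1 A_le2).
    by have := no x; rewrite /ok xa x1 x2 x3.
  pose st := fix st j := if j is k.+1 then ((st k).2, nxt k (st k)) else (a, a).
  exists (fun j => (st j).2); split=> // j.
  have /and4P[h1 h2 h3 _] := okP j (st j).
  by have /and4P[_ _ _ h4] := okP j.+1 (st j.+1); split.
(* The neighbours of position [n.-1] are [n.-2], [n - 3], 0 and 1; the colour [a] of position 0 is
   already removed from the list. *)
have [b [ba b1 b2 b3]] := pick_avail (g n.-2) (g (n - 3)) (g 1) a4.
move: ba; rewrite in_setD1 => /andP[ba bL].
pose h r := if r == n.-1 then b else g r.
have Lmod := periodic_mod avail_per.
have rn i : i %% n < n by rewrite ltn_mod; lia.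
have eS i : i.+1 %% n = if i %% n == n.-1 then 0 else (i %% n).+1.
  by apply: modn_succ; lia.
exists (fun i => h (i %% n)); split=> i.
- by rewrite modnDr.
- rewrite -Lmod /h; case: eqP => [->//|_].
  by case: (i %% n) => [|r]; [rewrite g0 | case: (gP r)].
- rewrite eS /h; move: (i %% n) (rn i) => r rlt.
  case: (r =P n.-1) => [_|rn1]; last case: (r.+1 =P n.-1) => [rn2|_].
  + by rewrite ifF ?g0 //; lia.
  + by rewrite eq_sym (_ : r = n.-2) //; lia.
  + by rewrite eq_sym; case: (gP r).
- rewrite !eS /h; move: (i %% n) (rn i) => r rlt.
  case: (r =P n.-1) => [_|rn1].
    by rewrite /= !ifF //; lia.
  case: (r.+1 =P n.-1) => [rn2|rn2].
    rewrite ifF; last by lia.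
    by case: r rn1 rn2 rlt => [|r]; [lia | rewrite g0; case: (gP r)].
  case: (r.+2 =P n.-1) => [rn3|_].
    by rewrite eq_sym (_ : r = n - 3) //; lia.
  by rewrite eq_sym; case: (gP r).
Qed.

(** For even [n]: copies of 0123 if 4 divides [n], otherwise 012012 followed by copies of 0123.
    Blocks begin with 01 and end with 12 or 23, so every joint is proper. *)
Definition square_pattern r :=
  if n %% 4 == 0 then r %% 4 else if r < 6 then r %% 3 else (r - 6) %% 4.

Lemma even_square_colouring (L : {set 'I_9}) :
  ~~ odd n -> #|L| = 4 -> (forall i, avail A i = L) ->
  exists f, square_colouring f.
Proof.
move=> en L4 eqL.
have rn i : i %% n < n by rewrite ltn_mod; lia.
have p4 r : square_pattern r < 4.
  by rewrite /square_pattern; case: ifP => _; [lia | case: ifP => _; lia].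
have inj r s : square_pattern r != square_pattern s ->
    nth ord0 (enum L) (square_pattern r) != nth ord0 (enum L) (square_pattern s).
  by move=> ne; rewrite nth_uniq ?enum_uniq // -cardE L4.
have eS i : i.+1 %% n = if i %% n == n.-1 then 0 else (i %% n).+1.
  by apply: modn_succ; lia.
(* An even [n] above 2 that is 2 modulo 4 is at least 6, which leaves room for the prefix 012012. *)
have en4 : n %% 4 = 0 \/ n %% 4 = 2 /\ 5 < n by lia.
exists (fun i => nth ord0 (enum L) (square_pattern (i %% n))); split=> i.
- by rewrite modnDr.
- by rewrite eqL -mem_enum mem_nth // -cardE L4.
- apply: inj; rewrite eS; move: (i %% n) (rn i) => r rlt; rewrite /square_pattern.
  case: (r =P n.-1) => /= r1; case: en4 => [h|[h n5]]; rewrite h /=;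
    repeat (case: ifP => ?); lia.
- apply: inj; rewrite !eS; move: (i %% n) (rn i) => r rlt; rewrite /square_pattern.
  case: (r =P n.-1) => /= r1; first case: (0 =P n.-1) => /= r2.
  - lia.
  - by case: en4 => [h|[h n5]]; rewrite h /=; repeat (case: ifP => ?); lia.
  - by case: (r.+1 =P n.-1) => /= r2; case: en4 => [h|[h n5]]; rewrite h /=;
      repeat (case: ifP => ?); lia.
Qed.

End CycleListColouring.

(* If the greedy colouring fails at every starting point, then all lists are
   equal of size 4; then A i and A i.+1 partition a fixed set, so n is even. *)
Lemma cycle_list_colouring n (A : nat -> {set 'I_9}) :
  2 < n -> (forall i, A (i + n) = A i) -> (forall i, #|A i| <= 2) ->
  exists f, square_colouring n A f.
Proof.
move=> n3 Aper A2.
case: (classic (exists i a, a \in avail A i.+1 /\ 4 <= #|avail A i :\ a|)).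
  (* The rotation makes [i.+1] the starting point and [i] the last position. *)
  case=> i [a [ai a4]]; pose A' j := A (j + i.+1).
  have A'per j : A' (j + n) = A' j by rewrite /A' addnAC Aper.
  have avE j : avail A' j = avail A (j + i.+1) by [].
  have [|f [fper fL f1 f2]] := @greedy_square_colouring n A' n3 A'per (fun j => A2 _) a ai.
    by rewrite avE (_ : n.-1 + i.+1 = i + n) ?avail_per //; lia.
  (* Modulo [n], adding [n.-1 * i.+1] undoes the shift by [i.+1]. *)
  exists (fun j => f (j + n.-1 * i.+1)); split=> j.
  - by rewrite addnAC fper.
  - have := fL (j + n.-1 * i.+1); rewrite avE -addnA.
    rewrite (_ : n.-1 * i.+1 + i.+1 = i.+1 * n); last by nia.
    by rewrite (periodic_mulD (avail_per Aper)).
  - exact: f1.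
  - exact: f2.
move=> stuck.
have av i : #|avail A i| = 4 /\ avail A i.+1 \subset avail A i.
  have a4 a : a \in avail A i.+1 -> a \in avail A i /\ #|avail A i| = 4.
    move=> ai; have : ~ 4 <= #|avail A i :\ a| by move=> h; apply: stuck; exists i, a.
    have := card_avail i A2; rewrite (cardsD1 a).
    by move: #|_|; case: (a \in _) => /= m; lia.
  split; last by apply/subsetP=> a /a4[].
  have /card_gt0P[a /a4[]//] : 0 < #|avail A i.+1|.
  by have := card_avail i.+1 A2; lia.
have eqL i : avail A i = avail A 0.
  elim: i => // i <-; apply/eqP; rewrite eqEcard; case: (av i) => -> ->.
  by case: (av i.+1) => ->.
(* Five colours lie outside the list: [ord0], at most two in [A i] and at most two in [A i.+1]. All
   these bounds are therefore attained, without overlap. *)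
have part i : [/\ ord0 \notin A i, #|A i| = 2 & A i :&: A i.+1 = set0].
  suff [? ? /eqP] : [/\ ord0 \notin A i, #|A i| = 2 & #|A i :&: A i.+1| = 0].
    by rewrite cards_eq0 => /eqP.
  have [a4 _] := av i.
  have := cardsC (ord0 |: (A i :|: A i.+1)); rewrite card_ord -/(avail A i) a4.
  have := cardsU1 ord0 (A i :|: A i.+1); have := cardsU (A i) (A i.+1).
  have := A2 i; have := A2 i.+1; rewrite in_setU negb_or.
  move: #|A i| #|A i.+1| #|A i :&: _| #|A i :|: _| #|_ |: _| => a b m u u'.
  by case: (_ \notin A i); case: (_ \notin _) => /= *; first split; lia.
have en : ~~ odd n.
  have [_ A02 _] := part 0; have /card_gt0P[x x0] : 0 < #|A 0| by lia.
  (* A nonzero colour outside the common list lies in exactly one of [A i] and [A i.+1], so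
     membership alternates along the cycle. *)
  have flip i : (x \in A i.+1) = ~~ (x \in A i).
    have [o _ /setP/(_ x)] := part i; rewrite in_setI inE => dis.
    have xn0 : x != ord0 by have [o0 _ _] := part 0; apply: contraNneq o0 => <-.
    have : x \notin avail A i by rewrite eqL !inE x0 orbT.
    by rewrite !inE negbK (negPf xn0) /= => h; move: dis h; do 2! case: (x \in _).
  have par i : (x \in A i) = ~~ odd i.
    by elim: i => [|i IH]; rewrite ?x0 // flip IH.
  by rewrite -par -(add0n n) Aper.
exact: (even_square_colouring n3 en (proj1 (av 0)) eqL).
Qed.

(** * Shortest cycles *)

Section Cycles.
Variables (V : finType) (e : rel V).
Hypotheses (e_sym : symmetric e) (e_irr : irreflexive e).

Definition is_cycle n (v : nat -> V) :=
  [/\ 2 < n, forall i, v (i + n) = v i,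
      forall i j, v i = v j -> i = j %[mod n] & forall i, e (v i) (v i.+1)].

Lemma fold_is_cycle n (h : nat -> V) :
  2 < n -> (forall i, i.+1 < n -> e (h i) (h i.+1)) -> e (h n.-1) (h 0) ->
  (forall i j, i < n -> j < n -> h i = h j -> i = j) ->
  is_cycle n (fun i => h (i %% n)).
Proof.
move=> n3 hS h0 inj; have rn i : i %% n < n by rewrite ltn_mod; lia.
split=> // [i|i j|i]; first by rewrite modnDr.
  exact: inj.
have -> : i.+1 %% n = if i %% n == n.-1 then 0 else (i %% n).+1.
  by apply: modn_succ; lia.
case: eqP => [->//|ne]; apply: hS; move: (rn i); lia.
Qed.

(** Induction on the return time [d]: a repetition inside gives a shorter return, and otherwise the
    segment is itself a cycle. Irreflexivity excludes [d = 1], the absence of backtracking excludes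
    [d = 2]. *)
Lemma closed_walk_cycle (g : nat -> V) d i :
  (forall i, e (g i) (g i.+1)) -> (forall i, g i.+2 != g i) ->
  0 < d -> g i = g (i + d) -> exists n v, is_cycle n v.
Proof.
move=> g1 g2; elim/ltn_ind: d i => d IH i d0 gid.
have d1 : d != 1.
  by apply/eqP=> d1; move: (g1 i); rewrite gid d1 addn1 e_irr.
have d2 : d != 2.
  by apply/eqP=> d2; move: (g2 i); rewrite gid d2 addn2 eqxx.
case: (classic (exists a b, [/\ a < b, b < d & g (i + a) = g (i + b)])).
  case=> a [b [ab bd gab]]; apply: (IH (b - a) _ (i + a)); [lia | lia |].
  by rewrite gab; congr g; lia.
move=> no; exists d; eexists; apply: (@fold_is_cycle d (fun k => g (i + k))).
- lia.
- by move=> k _; rewrite addnS.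
- by rewrite addn0 gid -[d in X in e _ X](prednK d0) addnS.
- move=> a b ad bd gab; case: (ltngtP a b) => // ab; case: no.
    by exists a, b.
  by exists b, a.
Qed.

(** A walk that never turns back can always be prolonged, and by the pigeonhole principle it repeats
    a vertex. The state of the walk is its current directed edge. *)
Lemma exists_cycle :
  (forall x y, e x y -> exists2 z, e y z & z != x) ->
  (exists x y, e x y) -> exists n v, is_cycle n v.
Proof.
move=> ext [x [y xy]].
pose stp p := (p.2, odflt p.2 [pick z | e p.2 z && (z != p.1)]).
have stpP p : e p.1 p.2 -> e (stp p).1 (stp p).2 /\ (stp p).2 != p.1.
  move=> /ext[z yz zx]; rewrite /stp /=; case: pickP => [w /andP[]//|no].
  by have := no z; rewrite yz zx.
pose st := fun k => iter k stp (x, y).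
have stE k : e (st k).1 (st k).2 by elim: k => // k IH; case: (stpP _ IH).
pose g k := (st k).1.
have g1 k : e (g k) (g k.+1) by apply: stE.
have g2 k : g k.+2 != g k by case: (stpP _ (stE k)).
have : ~~ injectiveb (fun k : 'I_(#|V|.+1) => g k).
  apply/injectiveP=> inj; have := leq_card _ inj.
  by rewrite card_ord ltnn.
case/injectivePn=> i [j ij gij]; case: (ltngtP i j) => [lt|lt|/val_inj eq].
- apply: (@closed_walk_cycle g (j - i) i) => //; rewrite ?subnKC ?subn_gt0 //; lia.
- apply: (@closed_walk_cycle g (i - j) j) => //; rewrite ?subnKC ?subn_gt0 //; lia.
- by rewrite eq eqxx in ij.
Qed.

Lemma shortest_cycle :
  (exists n v, is_cycle n v) ->
  exists n v, is_cycle n v /\ forall m w, is_cycle m w -> n <= m.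
Proof.
case=> n; elim/ltn_ind: n => n IH [v nv].
case: (classic (exists m w, m < n /\ is_cycle m w)) => [[m [w [mn mw]]]|no].
  by apply: (IH m) => //; exists w.
exists n, v; split=> // m w mw; rewrite leqNgt; apply/negP=> mn.
by apply: no; exists m, w.
Qed.

Variables (n : nat) (v : nat -> V).
Hypotheses (cyc : is_cycle n v) (n_min : forall m w, is_cycle m w -> n <= m).

Lemma cycle_arc_inj i a b : a < n -> b < n -> v (i + a) = v (i + b) -> a = b.
Proof.
have [_ _ inj _] := cyc; move=> an bn /inj /eqP.
by rewrite eqn_modDl !modn_small // => /eqP.
Qed.

(** The chord closes the arc of length [d] into a cycle with [d.+1] vertices. *)
Lemma shortest_cycle_chordless i d :
  0 < d < n -> e (v i) (v (i + d)) -> d = 1 \/ d = n.-1.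
Proof.
move=> dn ed; have [_ _ _ vS] := cyc; case: (d =P 1) => [|d1]; [by left | right].
suff : n <= d.+1 by lia.
apply: n_min; apply: (@fold_is_cycle _ (fun k => v (i + k))).
- lia.
- by move=> k _; rewrite addnS.
- by rewrite addn0 /= e_sym.
- by move=> a b ad bd; apply: cycle_arc_inj; lia.
Qed.

(** The vertex [x] closes the arc of length [d] into a cycle with [d.+2] vertices. *)
Lemma shortest_cycle_common_half i d x :
  (forall j, v j != x) -> 0 < d < n -> e x (v i) -> e x (v (i + d)) -> n <= d.+2.
Proof.
move=> xv dn xi xd; have [_ _ _ vS] := cyc.
apply: n_min.
apply: (@fold_is_cycle _ (fun k => if k == d.+1 then x else v (i + k))).
- lia.
- move=> k kd; rewrite ifF; last by lia.
  by case: eqP => [[->]|_]; [rewrite e_sym | rewrite addnS].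
- by rewrite /= eqxx addn0.
- move=> a b ad bd; case: eqP => [->|a1]; case: eqP => [->|b1] //.
  + by move/esym/eqP; rewrite (negPf (xv _)).
  + by move/eqP; rewrite (negPf (xv _)).
  + by apply: cycle_arc_inj; lia.
Qed.

(** Both arcs between the two neighbours of [x] obey the previous bound; hence this situation occurs
    only for [n <= 4]. *)
Lemma shortest_cycle_common i d x :
  (forall j, v j != x) -> 0 < d < n -> e x (v i) -> e x (v (i + d)) ->
  d <= 2 /\ n - d <= 2.
Proof.
move=> xv dn xi xd; have [_ vper _ _] := cyc.
have h1 := shortest_cycle_common_half xv dn xi xd.
have := @shortest_cycle_common_half (i + d) (n - d) x xv.
rewrite -addnA subnKC; last by lia.
by rewrite vper => h2; have : n <= (n - d).+2 by [apply: h2 => //; lia]; lia.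
Qed.

End Cycles.

(** * Partial colourings and their extension *)

Lemma card_bigcup_le (I T : finType) (P : {set I}) (F : I -> {set T}) m :
  (forall i, i \in P -> #|F i| <= m) -> #|\bigcup_(i in P) F i| <= #|P| * m.
Proof.
move=> Fm; rewrite -sum_nat_const.
elim/big_rec2: _ => [|i k B iP IH]; first by rewrite cards0.
by rewrite (leq_trans (leq_card_setU _ _)) // leq_add ?Fm.
Qed.

Section Colourings.
Variables (V : finType) (e : rel V).
Hypotheses (e_sym : symmetric e) (e_irr : irreflexive e).

Definition nbrs x := [set y | e x y].

Implicit Types c : V -> V -> 'I_9.

Definition csym c := forall x y, c x y = c y x.

(* Colour 0 also stands for "not coloured yet". *)
Definition strong c := forall x y z w, e x y -> e x z -> z != y -> e z w ->
  c x y != ord0 -> c x y != c z w.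

Definition zero_ok c :=
  (forall x y, e x y -> c x y = ord0 -> #|nbrs x| = 3) /\
  (forall x y z, e x y -> e x z -> c x y = ord0 -> c x z = ord0 -> y = z).

Definition good c := [/\ csym c, strong c & zero_ok c].

Definition colours c x := [set c x y | y in nbrs x] :\ ord0.

(** The nonzero colours that the edge [x y] has to avoid at its end [x]. Edges [x z] are counted
    too, as edges at [z]. *)
Definition side c x y := \bigcup_(z in nbrs x :\ y) colours c z.

Definition upd c x y a : V -> V -> 'I_9 := fun p q =>
  if ((p == x) && (q == y)) || ((p == y) && (q == x)) then a else c p q.

Lemma upd_sym c x y a : csym c -> csym (upd c x y a).
Proof.
move=> cs p q; rewrite /upd cs orbC.
by rewrite ![_ && (p == _)]andbC.
Qed.

Lemma updE c x y a : upd c x y a x y = a.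
Proof. by rewrite /upd !eqxx. Qed.

Lemma upd_out c x y a p q : p != x -> p != y -> upd c x y a p q = c p q.
Proof. by rewrite /upd => /negPf-> /negPf->. Qed.

Lemma mem_colours c x y : e x y -> c x y != ord0 -> c x y \in colours c x.
Proof. by move=> xy n0; rewrite !inE n0; apply: imset_f; rewrite inE. Qed.

Lemma mem_side c x y z w :
  e x z -> z != y -> e z w -> c z w != ord0 -> c z w \in side c x y.
Proof.
move=> xz zy zw n0; apply/bigcupP; exists z; first by rewrite !inE zy.
exact: mem_colours.
Qed.

Lemma colours_n0 c x : ord0 \notin colours c x.
Proof. by rewrite !inE eqxx. Qed.

Lemma side_n0 c x y : ord0 \notin side c x y.
Proof. by apply/negP=> /bigcupP[z _]; rewrite (negPf (colours_n0 _ _)). Qed.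

Lemma card_colours c x (D : {set V}) :
  (forall y, e x y -> c x y != ord0 -> y \in D) -> #|colours c x| <= #|D|.
Proof.
move=> hD; apply: leq_trans (leq_imset_card (c x) (mem D)).
apply: subset_leq_card; apply/subsetP=> a; rewrite !inE => /andP[a0 /imsetP[y]].
rewrite inE => xy ay; apply/imsetP; exists y => //.
by apply: hD => //; rewrite -ay.
Qed.

Lemma card_colours_le c x : #|colours c x| <= #|nbrs x|.
Proof. by apply: card_colours => y xy _; rewrite inE. Qed.

Lemma card_side c x y m :
  (forall z, e x z -> z != y -> #|colours c z| <= m) ->
  #|side c x y| <= #|nbrs x :\ y| * m.
Proof. by move=> h; apply: card_bigcup_le => z; rewrite !inE => /andP[zy xz]; apply: h. Qed.

Lemma sub_colours c c' x :
  (forall y, e x y -> c' x y = c x y \/ c' x y = ord0) ->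
  colours c' x \subset colours c x.
Proof.
move=> h; apply/subsetP=> a; rewrite !inE => /andP[a0 /imsetP[y]].
rewrite inE => xy ay; rewrite a0 /=; apply/imsetP; exists y; rewrite ?inE //.
by case: (h y xy) => h0; [rewrite -h0 | rewrite ay h0 eqxx in a0].
Qed.

Lemma sub_side c c' x y :
  (forall z w, e x z -> z != y -> e z w -> c' z w = c z w \/ c' z w = ord0) ->
  side c' x y \subset side c x y.
Proof.
move=> h; apply/bigcupsP=> z zP; apply: subset_trans (bigcup_sup z zP).
move: zP; rewrite !inE => /andP[zy xz].
by apply: sub_colours => w zw; apply: h.
Qed.

(** A new conflict must involve the recoloured edge, and the two [side] sets collect the colours of
    all edges close to it. *)
Lemma strong_upd c x y a : csym c -> strong c ->
  a \notin side c x y -> a \notin side c y x -> strong (upd c x y a).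
Proof.
move=> cs cst ax ay p q z w pq pz zq zw.
have key r s t u : (r, s) = (x, y) \/ (r, s) = (y, x) -> e r t -> t != s -> e t u ->
    a != ord0 -> a != c t u.
  move=> rs rt ts tu a0; apply/eqP=> ac.
  case: rs => -[? ?]; subst r s.
    by move/negP: ax; apply; rewrite ac; apply: mem_side => //; rewrite -ac.
  by move/negP: ay; apply; rewrite ac; apply: mem_side => //; rewrite -ac.
have isxy r s : (((r == x) && (s == y)) || ((r == y) && (s == x))) ->
    (r, s) = (x, y) \/ (r, s) = (y, x).
  by case/orP=> /andP[/eqP-> /eqP->]; [left | right].
rewrite /upd; case: ifP => [/isxy Epq|Npq]; case: ifP => [/isxy Ezw|Nzw].
- move=> _; exfalso; move: pq zq pz zw.
  by case: Epq Ezw => -[-> ->] [] [-> ->]; rewrite ?eqxx ?e_irr.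
- exact: key Epq pz zq zw.
(* The conflict is read backwards, from the edge [z w] through [p] to [q]. If [p = w], the two edges
   share [w], and the route from [w] through [q] is taken instead. *)
- move=> c0; apply/eqP=> ca; have a0 : a != ord0 by rewrite -ca.
  have := key z w p q Ezw; rewrite e_sym pz pq ca eqxx.
  case: (p =P w) => [pw|_] h; last by have := h isT isT isT a0.
  have Ewz : (w, z) = (x, y) \/ (w, z) = (y, x).
    by case: Ezw => -[-> ->]; [right | left].
  have := key w z q p Ewz; rewrite -pw pq e_sym pq eq_sym zq cs ca eqxx => h2.
  by have := h2 isT isT isT a0.
- exact: cst.
Qed.

(** Eight nonzero colours against at most seven forbidden ones; the later counts for single edges
    aim at this bound. *)
Lemma extend c x y : csym c -> strong c -> #|side c x y :|: side c y x| <= 7 ->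
  exists a, [/\ a != ord0, csym (upd c x y a) & strong (upd c x y a)].
Proof.
move=> cs cst le7; set B := _ :|: _ in le7.
have : 0 < #|~: (ord0 |: B)|.
  have := cardsC (ord0 |: B); rewrite card_ord cardsU1; case: (_ \notin _); lia.
case/card_gt0P=> a; rewrite !inE !negb_or => /and3P[a0 ax ay].
by exists a; split=> //; [apply: upd_sym | apply: strong_upd].
Qed.

Lemma strong_zero c x y : csym c -> strong c -> strong (upd c x y ord0).
Proof. by move=> cs cst; apply: strong_upd => //; apply: side_n0. Qed.

(** The bound is required of every colouring that agrees with [c] off [s], because the intermediate
    colourings depend on the choices made. *)
Lemma greedy c (s : seq (V * V)) : csym c -> strong c ->
  (forall c', csym c' -> strong c' ->
     (forall x y, c' x y = c x y \/ (x, y) \in s \/ (y, x) \in s) ->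
     forall x y, (x, y) \in s -> #|side c' x y :|: side c' y x| <= 7) ->
  exists c', [/\ csym c', strong c',
    forall x y, c' x y = c x y \/ (x, y) \in s \/ (y, x) \in s
    & forall x y, (x, y) \in s -> c' x y != ord0].
Proof.
move=> cs cst; elim: s => [|[p q] s IH] bnd.
  by exists c; split=> //; left.
have [|c' [c's c'st agr n0]] := IH.
  move=> c' c's c'st agr x y xy; apply: bnd => // [x' y'|].
    by case: (agr x' y') => [|[|]] h; rewrite ?inE;
      [left | right; left | right; right]; rewrite ?h ?orbT.
  by rewrite inE xy orbT.
have [|a [a0 us ust]] := @extend c' p q c's c'st.
  apply: bnd => //; last by rewrite inE eqxx.
  by move=> x' y'; case: (agr x' y') => [|[|]] h; rewrite ?inE;
    [left | right; left | right; right]; rewrite ?h ?orbT.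
exists (upd c' p q a); split=> // x y.
  rewrite /upd !inE !xpair_eqE; case: ifP => [/orP[]/andP[/eqP-> /eqP->]|_].
  - by right; left; rewrite !eqxx.
  - by right; right; rewrite !eqxx.
  - by case: (agr x y) => [|[|]] h; [left | right; left | right; right]; rewrite ?h ?orbT.
rewrite inE /upd xpair_eqE; case: ifP => // /norP[/negPf-> _] /=; exact: n0.
Qed.

End Colourings.

(** * Vertices of degree one and two *)

(** The vertices of [S] become isolated and the vertex type stays the same, so colourings need no
    transport. *)
Definition del (V : finType) (e : rel V) (S : {set V}) : rel V :=
  fun x y => [&& e x y, x \notin S & y \notin S].

Section Deletion.
Variables (V : finType) (e : rel V).
Hypothesis e_deg : forall x, #|nbrs e x| <= 3.

Lemma del_sub S x y : del e S x y -> e x y.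
Proof. by case/and3P. Qed.

Lemma del_nbrs S x : nbrs (del e S) x \subset nbrs e x.
Proof. by apply/subsetP=> y; rewrite !inE => /del_sub. Qed.

Lemma del_deg3 S x : #|nbrs (del e S) x| = 3 -> #|nbrs e x| = 3.
Proof. by have := subset_leq_card (del_nbrs S x); have := e_deg x; lia. Qed.

Definition blank (S : {set V}) (c : V -> V -> 'I_9) x y :=
  if (x \in S) || (y \in S) then ord0 else c x y.

(* Two edges avoiding S at distance 2 are joined by an edge avoiding S, so
   deleting S loses no conflict between surviving edges. *)
Lemma strong_blank S c : strong (del e S) c -> strong e (blank S c).
Proof.
move=> cst x y z w xy xz zy zw; rewrite /blank.
case: ifP => [_|/norP[xS yS]]; first by rewrite eqxx.
case: ifP => [//|/norP[zS wS]]; apply: cst => //; by apply/and3P.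
Qed.

Lemma sym_blank S c : csym c -> csym (blank S c).
Proof. by move=> cs x y; rewrite /blank orbC cs. Qed.

Lemma card_side_le c x y : #|side e c x y| <= #|nbrs e x :\ y| * 3.
Proof. by apply: card_side => z _ _; apply: leq_trans (card_colours_le e c z) _. Qed.

End Deletion.

Section SmallDegree.
Variables (V : finType) (e : rel V).
Hypotheses (e_sym : symmetric e) (e_irr : irreflexive e).
Hypothesis e_deg : forall x, #|nbrs e x| <= 3.
Variables (v : V).

(** Colour 0 at [v] means uncoloured, so the conditions concern only edges avoiding [v]. Degrees are
    those of [e], not of the smaller graph. *)
Definition zero_ok_off (c : V -> V -> 'I_9) :=
  [/\ forall x y, x != v -> y != v -> e x y -> c x y = ord0 -> #|nbrs e x| = 3,
      forall x y z, x != v -> y != v -> z != v -> e x y -> e x z ->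
        c x y = ord0 -> c x z = ord0 -> y = z
    & forall y, c v y = ord0].

Definition partial c := [/\ csym c, strong e c & zero_ok_off c].

Lemma partial_blank c : good (del e [set v]) c -> partial (blank [set v] c).
Proof.
case=> cs cst [z3 zm]; split; [exact: sym_blank | exact: strong_blank | split].
- move=> x y xv yv xy; rewrite /blank !inE (negPf xv) (negPf yv) /= => c0.
  apply: (@del_deg3 _ _ e_deg [set v]); apply: z3 c0.
  by rewrite /del xy !inE xv yv.
- move=> x y z xv yv zv xy xz; rewrite /blank !inE (negPf xv) (negPf yv) (negPf zv) /=.
  by move=> cy cz; apply: (zm x) => //; rewrite /del ?xy ?xz !inE xv ?yv ?zv.
- by move=> y; rewrite /blank !inE eqxx.
Qed.

(** Once no edge at [v] is blank, every edge of colour 0 avoids [v]. *)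
Lemma good_of_partial c c' : partial c -> csym c' -> strong e c' ->
  (forall x y, x != v -> y != v -> c' x y = c x y) ->
  (forall x, e v x -> c' v x != ord0) -> good e c'.
Proof.
move=> [_ _ [z3 zm _]] c's c'st agr vn0.
have off x y : e x y -> c' x y = ord0 -> x != v /\ y != v.
  move=> xy c0; split; apply/eqP=> E; subst.
    by move: (vn0 y xy); rewrite c0 eqxx.
  by move: (vn0 x); rewrite e_sym xy c's c0 eqxx => /(_ isT).
split=> //; split=> [x y xy c0|x y z xy xz cy cz].
  by have [xv yv] := off _ _ xy c0; apply: (z3 x y) => //; rewrite -agr.
have [xv yv] := off _ _ xy cy; have [_ zv] := off _ _ xz cz.
by apply: (zm x) => //; rewrite -agr.
Qed.

Lemma nbrs_card2 x y (D : {set V}) : e x y -> y \notin D -> D \subset nbrs e x ->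
  #|D| <= 2.
Proof.
move=> xy yD Dx; have := subset_leq_card (_ : y |: D \subset nbrs e x).
rewrite cardsU1 yD => /(_ _)/leq_trans/(_ (e_deg x)); apply.
by rewrite subUset sub1set inE xy.
Qed.

Lemma card_nbrsD1 x y : e x y -> #|nbrs e x :\ y| <= 2.
Proof.
by move=> xy; apply: (nbrs_card2 xy); rewrite ?subD1set // !inE eqxx.
Qed.

Lemma card_colours2 c x y : e x y -> c x y = ord0 -> #|colours e c x| <= 2.
Proof.
move=> xy c0; apply: leq_trans (card_nbrsD1 xy); apply: card_colours => z xz cz.
by rewrite !inE xz andbT; apply: contraNneq cz => ->; rewrite c0.
Qed.

(* One of these two states can be reached at each neighbour x of v by turning
   at most one edge at x into colour 0. *)
Definition saved c x := #|colours e c x| <= 1 /\ #|side e c x v| <= 5.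
Definition ready c x :=
  saved c x \/ #|colours e c x| <= 2 /\ #|side e c x v| <= 4.

Definition weaker (c' c : V -> V -> 'I_9) := forall x y, c' x y = c x y \/ c' x y = ord0.

Lemma weaker_ready c c' x : weaker c' c -> ready c x -> ready c' x.
Proof.
move=> w; have h1 : #|colours e c' x| <= #|colours e c x|.
  by apply/subset_leq_card/sub_colours.
have h2 : #|side e c' x v| <= #|side e c x v| by apply/subset_leq_card/sub_side.
by case=> -[a b]; [left | right]; split; apply: leq_trans; eauto.
Qed.

(** Besides [v], the vertex [x] has at most two neighbours: [u] and one more. *)
Lemma side_card2 c x m k u : e x v -> e x u -> u != v ->
  #|colours e c u| <= m ->
  (forall y, e x y -> y != v -> y != u -> #|colours e c y| <= k) ->
  #|side e c x v| <= m + k.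
Proof.
move=> xv xu uv cu ck.
have -> : side e c x v = colours e c u :|: \bigcup_(z in nbrs e x :\ v :\ u) colours e c z.
  by rewrite /side (big_setD1 u) // !inE uv.
apply: leq_trans (leq_card_setU _ _) _; apply: leq_add => //.
apply: leq_trans (card_bigcup_le (m := k) _) _.
  by move=> y; rewrite !inE => /and3P[yu yv xy]; apply: ck.
have := card_nbrsD1 xv; rewrite (cardsD1 u) !inE uv xu /= => h.
by rewrite -[leqRHS]mul1n leq_mul2r; apply/orP; right; lia.
Qed.

(** If some edge [x u] away from [v] has colour 0, or may be given it, then [x] keeps at most one
    colour and [u] at most two: the saved state. Otherwise [x] has at most one neighbour besides
    [v], or each such neighbour shows at most two colours. *)
Lemma make_ready c x : partial c -> e v x ->
  exists c', [/\ partial c', weaker c' c & ready c' x].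
Proof.
move=> cP vx; have [cs cst [z3 zm zv]] := cP.
have xv : e x v by rewrite e_sym.
have xnv : x != v by apply: contraTneq vx => ->; rewrite e_irr.
have c3 y : #|colours e c y| <= 3 by apply: leq_trans (card_colours_le _ _ _) _.
have wcc : weaker c c by left.
case: (classic (exists u, [/\ e x u, u != v & c x u = ord0])).
  case=> u [xu uv cu]; exists c; split=> //; left; split.
    have : #|nbrs e x :\ v :\ u| <= 1.
      have := card_nbrsD1 xv; rewrite (cardsD1 u) !inE uv xu /=; lia.
    apply: leq_trans; apply: card_colours => y xy cy; rewrite !inE xy andbT.
    by apply/andP; split; apply: contraNneq cy => ->; rewrite ?cu // cs zv.
  apply: (side_card2 (m := 2) (k := 3) xv xu uv) => //.
  by apply: (@card_colours2 _ _ x); rewrite 1?cs // e_sym.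
move=> nox.
have xc : #|colours e c x| <= 2 by apply: card_colours2 xv _; rewrite cs.
(* These conditions allow recolouring [x u] with 0: both ends have degree 3, and neither has an edge
   of colour 0 away from [v]. *)
case: (classic (exists u, [/\ e x u, u != v, #|nbrs e x| = 3, #|nbrs e u| = 3
   & forall z, e u z -> z != v -> c u z != ord0])); last first.
  move=> nou; exists c; split=> //; right; split=> //.
  case: (leqP #|nbrs e x :\ v| 1) => [le1|gt1].
    by apply: leq_trans (card_side_le e_deg c x v) _; lia.
  have x3 : #|nbrs e x| = 3.
    by move: gt1; have := e_deg x; rewrite (cardsD1 v) inE xv /=; lia.
  have /card_gt0P[u] : 0 < #|nbrs e x :\ v| by lia.
  rewrite !inE => /andP[uv xu].
  suff two y : e x y -> y != v -> #|colours e c y| <= 2.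
    by apply: (side_card2 (m := 2) (k := 2) xv xu uv) => // *; apply: two.
  move=> xy yv; case: (ltngtP #|nbrs e y| 3) => [lt|gt|y3].
  - by apply: leq_trans (card_colours_le _ _ _) _.
  - by have := e_deg y; lia.
  - case: (classic (exists z, [/\ e y z, z != v & c y z = ord0])).
      by case=> z [yz _ /card_colours2]; apply.
    move=> noz; case: nou; exists y; split=> // z yz zv'.
    by apply/eqP=> cz; apply: noz; exists z.
case=> u [xu uv x3 u3 nou]; exists (upd c x u ord0).
have wk : weaker (upd c x u ord0) c.
  by move=> p q; rewrite /upd; case: ifP => _; [right | left].
have unx : u != x by apply: contraTneq xu => ->; rewrite e_irr.
split=> //; first split.
- exact: upd_sym.
- exact: strong_zero.
- split=> [p q pv qv pq|p q r pv qv rv pq pr|q].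
  + rewrite /upd; case: ifP => [/orP[]/andP[/eqP-> _]|_] //; exact: z3 pq.
  + have nox' y : e x y -> y != v -> c x y = ord0 -> False.
      by move=> xy yv cy; apply: nox; exists y.
    have nou' y : e u y -> y != v -> c u y = ord0 -> False.
      by move=> uy yv cy; have := nou y uy yv; rewrite cy eqxx.
    rewrite /upd; case: ifP => [|_]; case: ifP => [|_].
    * case/orP=> /andP[/eqP p1 /eqP q1] /orP[]/andP[/eqP p2 /eqP r2] _ _;
        by [rewrite q1 r2 | rewrite -p1 -p2 eqxx in unx].
    * by move=> /orP[]/andP[/eqP E _] _ cr; subst p;
        [case: (nox' r) | case: (nou' r)].
    * by move=> /orP[]/andP[/eqP E _] cq _; subst p;
        [case: (nox' q) | case: (nou' q)].
    * exact: zm.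
  + by rewrite upd_out ?zv // eq_sym.
- left; split.
    have : #|nbrs e x :\ v :\ u| <= 1.
      have := card_nbrsD1 xv; rewrite (cardsD1 u) !inE uv xu /=; lia.
    apply: leq_trans; apply: card_colours => y xy; rewrite !inE xy andbT.
    rewrite /upd; case: ifP => [|h cy]; first by rewrite eqxx.
    apply/andP; split; first by apply: contraFneq h => ->; rewrite !eqxx.
    by apply: contraNneq cy => ->; rewrite cs zv.
  apply: (side_card2 (m := 2) (k := 3) xv xu uv).
    apply: (@card_colours2 _ _ x); first by rewrite e_sym.
    by rewrite upd_sym // updE.
  by move=> y _ _ _; apply: leq_trans (card_colours_le _ _ _) _.
Qed.

(** The new edge sees nothing through [v], and at most 2 * 3 colours through [x]. *)
Lemma degree1_step c x : nbrs e v = [set x] -> good (del e [set v]) c ->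
  exists c', good e c'.
Proof.
move=> nv /partial_blank; set c0 := blank _ _ => cP; have [cs cst [z3 zm zv]] := cP.
have vx : e v x by move: (set11 x); rewrite -nv inE.
have xv : e x v by rewrite e_sym.
have s0 : side e c0 v x = set0.
  by rewrite /side nv setDv big_set0.
have [|a [a0 us ust]] := @extend _ _ e_sym e_irr c0 v x cs cst.
  rewrite s0 set0U; apply: leq_trans (card_side_le e_deg c0 x v) _.
  by have := card_nbrsD1 xv; lia.
exists (upd c0 v x a); apply: good_of_partial cP us ust _ _.
  by move=> p q pv qv; rewrite /upd (negPf pv) (negPf qv) andbF.
have evE y : e v y = (y == x) by rewrite -in_set1 -nv inE.
by move=> y; rewrite evE => /eqP->; rewrite updE.
Qed.

(* The edge vx is coloured first, while vy is still blank. *)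
Lemma degree2_finish c x y : nbrs e v = [set x; y] -> x != y -> partial c ->
  ready c y -> (saved c x \/ [/\ #|colours e c x| <= 2, #|side e c x v| <= 4,
    #|colours e c y| <= 2 & #|side e c y v| <= 4]) ->
  exists c', good e c'.
Proof.
move=> nv xy cP ry rx; have [cs cst [z3 zm zv]] := cP.
have evE z : e v z = (z == x) || (z == y).
  by rewrite -in_set2 -nv inE.
have vx : e v x by rewrite evE eqxx.
have vy : e v y by rewrite evE eqxx orbT.
have xv : e x v by rewrite e_sym.
have yv : e y v by rewrite e_sym.
have xnv : x != v by apply: contraTneq vx => ->; rewrite e_irr.
have ynv : y != v by apply: contraTneq vy => ->; rewrite e_irr.
have sx c' : side e c' v x = colours e c' y.
  by rewrite /side nv setU1K ?big_set1 // inE.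
have sy c' : side e c' v y = colours e c' x.
  by rewrite /side nv setUC setU1K ?big_set1 // inE eq_sym.
(* If [x] and [y] are adjacent, the colours at one already occur in the [side] of the other, and the
   crude bound 2 * 3 suffices. *)
have tri c' p q : e p q -> e q v -> p != v -> #|colours e c' p :|: side e c' q v| <= 6.
  move=> pq qv pv; have -> : colours e c' p :|: side e c' q v = side e c' q v.
    by apply/setUidPr; apply: bigcup_sup; rewrite !inE pv e_sym.
  by apply: leq_trans (card_side_le e_deg c' q v) (leq_mul (card_nbrsD1 qv) (leqnn 3)).
have cy2 : #|colours e c y| <= 2 by case: ry => -[] // /leq_trans->.
have [|a [a0 us ust]] := @extend _ _ e_sym e_irr c v x cs cst.
  rewrite sx; case exy: (e x y).
    by apply: leq_trans (tri c y x _ _ _) _; rewrite // e_sym.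
  apply: leq_trans (leq_card_setU _ _) _.
  rewrite addnC; case: rx => [[_ h]|[_ h _ _]]; first exact: leq_add h cy2.
  by apply: leq_trans (leq_add h cy2) _.
set c1 := upd c v x a in us ust.
have c1out p q : p != v -> q != v -> c1 p q = c p q.
  by move=> pv qv; rewrite /c1 /upd (negPf pv) (negPf qv) andbF.
have [|b [b0 us2 ust2]] := @extend _ _ e_sym e_irr c1 v y us ust.
  rewrite sy; case exy: (e x y).
    by apply: leq_trans (tri c1 x y _ _ _) _.
  (* Colouring [v x] adds at most one colour at [x]. The count for [v y] is then at most 2 + 5 if
     [x] is saved, and 3 + 4 otherwise. *)
  have c1x : #|colours e c1 x| <= #|colours e c x|.+1.
    apply: leq_trans (_ : #|a |: colours e c x| <= _); last first.
      by rewrite cardsU1; case: (_ \notin _).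
    apply: subset_leq_card; apply/subsetP=> k; rewrite !inE.
    case/andP=> k0 /imsetP[z]; rewrite inE => xz kz; rewrite k0 /=.
    case: (z =P v) => [zv'|/eqP znv].
      by rewrite kz zv' us /c1 updE eqxx.
    by apply/orP; right; apply/imsetP; exists z; rewrite ?inE // kz c1out.
  have c1x' k : #|colours e c x| <= k -> #|colours e c1 x| <= k.+1.
    by move=> h; apply: leq_trans c1x _.
  have s1y : side e c1 y v \subset side e c y v.
    apply: sub_side => z w yz zv' zw; left.
    have zx : z != x by apply: contraFneq exy => <-; rewrite e_sym.
    by rewrite /c1 upd_out.
  have := subset_leq_card s1y => {}s1y.
  apply: leq_trans (leq_card_setU _ _) _.
  case: rx => [[cx _]|[cx _ _ syv]]; last first.
    exact: leq_add (c1x' _ cx) (leq_trans s1y syv).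
  apply: leq_add (c1x' _ cx) (leq_trans s1y _).
  by case: ry => -[_] // /leq_trans->.
exists (upd c1 v y b); apply: good_of_partial cP us2 ust2 _ _.
  by move=> p q pv qv; rewrite /upd (negPf pv) (negPf qv) andbF c1out.
move=> z; rewrite evE => /orP[]/eqP->; last by rewrite updE.
rewrite /upd eqxx (negPf xy) (negPf xnv) andbF /=.
by rewrite /c1 updE andbF.
Qed.

Lemma degree2_step c x y : nbrs e v = [set x; y] -> x != y ->
  good (del e [set v]) c -> exists c', good e c'.
Proof.
move=> nv xy /partial_blank c0P.
have evE z : e v z = (z == x) || (z == y).
  by rewrite -in_set2 -nv inE.
have [|c1 [c1P _ r1x]] := make_ready (x := x) c0P; first by rewrite evE eqxx.
have [|c2 [c2P w2 ry]] := make_ready (x := y) c1P; first by rewrite evE eqxx orbT.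
(* Preparing [y] only erases colours, so [x] stays ready. A saved neighbour then takes the part of
   [x] in [degree2_finish]. *)
have rx := weaker_ready w2 r1x.
case: (rx) => [sx|[cx sx]]; first by apply: (degree2_finish nv xy c2P ry); left.
case: (ry) => [sy|[cy sy]].
  by apply: (@degree2_finish c2 y x) => //; [rewrite setUC | rewrite eq_sym | left].
by apply: (degree2_finish nv xy c2P ry); right.
Qed.

End SmallDegree.

(** * Removing a shortest cycle of a cubic graph *)

Section CubicStep.
Variables (V : finType) (e : rel V).
Hypotheses (e_sym : symmetric e) (e_irr : irreflexive e).
(** Isolated vertices are allowed, so degree 3 is demanded only at the ends of edges. *)
Hypothesis e_cubic : forall x y, e x y -> #|nbrs e x| = 3.
Variables (n : nat) (v : nat -> V).
Hypotheses (cyc : is_cycle e n v) (n_min : forall m w, is_cycle e m w -> n <= m).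

Definition on_cycle := [set v i | i : 'I_n].
Local Notation C := on_cycle.

Let n3 : 2 < n. Proof. by case: cyc. Qed.
Let vper i : v (i + n) = v i. Proof. by case: cyc. Qed.
Let vinj i j : v i = v j -> i = j %[mod n]. Proof. by case: cyc => _ _ h _; apply: h. Qed.
Let vS i : e (v i) (v i.+1). Proof. by case: cyc. Qed.
Let vSr i : e (v i.+1) (v i). Proof. by rewrite e_sym. Qed.

Lemma cubic_deg x : #|nbrs e x| <= 3.
Proof.
case: (set_0Vmem (nbrs e x)) => [->|[y]]; first by rewrite cards0.
by rewrite inE => /e_cubic ->.
Qed.

Lemma on_cycleP x : reflect (exists i, x = v i) (x \in C).
Proof.
apply: (iffP imsetP) => [[i _ ->]|[i ->]]; first by exists i.
have ni : i %% n < n by rewrite ltn_mod; lia.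
by exists (Ordinal ni); rewrite //= (periodic_mod vper).
Qed.

Lemma v_on_cycle i : v i \in C.
Proof. by apply/on_cycleP; exists i. Qed.

Lemma v_off_cycle x i : x \notin C -> v i != x.
Proof. by apply: contraNneq => <-; apply: v_on_cycle. Qed.

(** Indices can be raised modulo [n], so that a predecessor on the cycle is named without
    subtraction. *)
Lemma on_cycle_shift x k : x \in C -> exists i, x = v (i + k).
Proof.
case/on_cycleP=> i ->; exists (i + k * n.-1).
by rewrite -(periodic_mulD vper k i); congr v; nia.
Qed.

Lemma on_cycle_from i x : x \in C -> exists2 d, d < n & x = v (i + d).
Proof.
case/(on_cycle_shift i) => j ->; exists (j %% n); first by rewrite ltn_mod; lia.
by rewrite addnC -(periodic_mod vper) [RHS](esym (periodic_mod vper _)) modnDmr.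
Qed.

Lemma cycle_step2_neq i : v i.+2 != v i.
Proof.
have [_ _ inj _] := cyc; apply/eqP=> E.
have := cycle_arc_inj cyc (i := i) (a := 2) (b := 0); rewrite addn2 addn0 E.
by move=> /(_ n3 (ltnW (ltnW n3)) erefl).
Qed.

Lemma cycle_nbr_on i x : e (v i.+1) x -> x \in C -> x = v i \/ x = v i.+2.
Proof.
move=> ex /(on_cycle_from i.+1)[d dn E]; subst x.
case: d dn ex => [|d] dn ex; first by rewrite addn0 e_irr in ex.
case: (shortest_cycle_chordless e_sym cyc n_min (d := d.+1) _ ex) => [|->|->].
- by [].
- by right; rewrite addn1.
- by left; rewrite -(vper i); congr v; lia.
Qed.

Lemma pendant_exists i : exists x, e (v i.+1) x /\ x \notin C.
Proof.
have : 0 < #|nbrs e (v i.+1) :\ v i :\ v i.+2|.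
  have := e_cubic (vS i.+1); rewrite (cardsD1 (v i)) (cardsD1 (v i.+2)) !inE.
  by rewrite vS vSr cycle_step2_neq /=; lia.
case/card_gt0P=> x; rewrite !inE => /and3P[x2 x0 ex].
exists x; split=> //; apply/negP=> /(cycle_nbr_on ex)[] E.
  by rewrite E eqxx in x0.
by rewrite E eqxx in x2.
Qed.

Lemma pendant_unique x y z : x \in C -> e x y -> y \notin C -> e x z -> z \notin C ->
  y = z.
Proof.
case/(on_cycle_shift 1)=> i; rewrite addn1 => -> ey yC ez zC.
apply/eqP; apply: contraT => yz.
have uq : uniq [:: v i; v i.+2; y; z].
  by rewrite /= !inE !negb_or eq_sym cycle_step2_neq !v_off_cycle // yz.
have : [:: v i; v i.+2; y; z] \subset nbrs e (v i.+1).
  by apply/subsetP=> w; rewrite !inE => /or4P[] /eqP->.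
by move/subset_leq_card; rewrite (e_cubic ey) (card_uniqP uq).
Qed.

Definition pend x := odflt x [pick y | e x y && (y \notin C)].
Local Notation u i := (pend (v i)).

Lemma pendP i : e (v i) (u i) /\ u i \notin C.
Proof.
have [x [ex xC]] : exists x, e (v i) x /\ x \notin C.
  have [j ->] := on_cycle_shift 1 (v_on_cycle i).
  by rewrite addn1; apply: pendant_exists.
by rewrite /pend; case: pickP => [y /andP[]//|/(_ x)]; rewrite ex xC.
Qed.

Lemma pend_eq i x : e (v i) x -> x \notin C -> x = u i.
Proof.
by case: (pendP i) => ? ? ? ?; apply: (pendant_unique (v_on_cycle i)).
Qed.

(* Every outer vertex keeps one distinguished edge to the cycle; this is the
   edge that receives colour 0. *)
Definition anchor y := odflt y [pick x | e y x && (x \in C)].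

Lemma anchorP y x : e y x -> x \in C -> e y (anchor y) /\ anchor y \in C.
Proof.
by move=> yx xC; rewrite /anchor; case: pickP => [z /andP[]//|/(_ x)]; rewrite yx xC.
Qed.

(** Cycle vertices with a common outer neighbour are at most two steps apart in both directions.
    This serves for coloured pendant edges just beyond a cycle edge: their outer end is also the
    outer neighbour of an end of that edge. *)
Lemma shared_pendant j m : v m != v j -> u m = u j ->
  (u j = u j.+1 \/ u j = u j.+2) /\
  (forall t, j = t.+2 -> u j = u t \/ u j = u t.+1).
Proof.
move=> mj E; have [d dn Em] := on_cycle_from j (v_on_cycle m).
have d0 : 0 < d by case: d Em {dn} => // Em; move: mj; rewrite Em addn0 eqxx.
have [e1 uC] := pendP j; have [e2 _] := pendP m.
have [||||d2 nd2] := @shortest_cycle_common _ _ e_sym _ _ cyc n_min j d (u j).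
- by move=> k; apply: v_off_cycle.
- by rewrite d0.
- by rewrite e_sym.
- by rewrite -Em -E e_sym.
rewrite -E Em; split.
  by case: d d0 d2 {Em nd2 dn} => [|[|[|]]] // _ _;
    [left; rewrite addn1 | right; rewrite addn2].
move=> t jt; have [nd|nd] : n - d = 1 \/ n - d = 2 by lia.
  by right; rewrite -[v t.+1]vper; do 2 congr (_ _); lia.
by left; rewrite -[v t]vper; do 2 congr (_ _); lia.
Qed.

Variable c0 : V -> V -> 'I_9.
Hypothesis c0_good : good (del e C) c0.

Lemma pendants_coloured : exists c, [/\ csym c, strong e c,
  (forall x y, x \notin C -> y \notin C -> c x y = c0 x y),
  (forall x y, e x y -> x \in C -> y \notin C -> (c x y == ord0) = (anchor y == x))
  & (forall x y, x \in C -> y \in C -> c x y = ord0)].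
Proof.
have [cs cst _] := c0_good.
pose b := blank C c0.
pose s := [seq p <- enum {: V * V} |
  [&& p.1 \in C, p.2 \notin C, e p.1 p.2 & anchor p.2 != p.1]].
have sE x y : ((x, y) \in s) = [&& x \in C, y \notin C, e x y & anchor y != x].
  by rewrite mem_filter mem_enum andbT.
have [|c [c1 c2 c3 c4]] := @greedy _ e e_sym e_irr b s (sym_blank C cs) (strong_blank cst).
  move=> c' c's c'st agr x y; rewrite sE => /and4P[xC yC xy ay].
  (* The edges of the cycle are still blank, so a cycle vertex shows at most the colour of its
     pendant edge. *)
  have c'1 z : z \in C -> #|colours e c' z| <= 1.
    case/on_cycleP=> i ->; apply: leq_trans (_ : #|[set u i]| <= 1); last by rewrite cards1.
    apply: card_colours => w ew cw.
    rewrite inE; apply/eqP/pend_eq => //; apply/negP=> wC; move: cw.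
    case: (agr (v i) w) => [->|]; first by rewrite /b /blank wC orbT eqxx.
    by rewrite !sE wC v_on_cycle /= ?andbF; case.
  apply: leq_trans (leq_card_setU _ _) _.
  have h1 : #|side e c' x y| <= 2 * 1.
    apply: leq_trans (card_side (m := 1) _) _.
      move=> z xz zy; apply: c'1; apply: contraNT zy => zC.
      by apply/eqP; apply: (pendant_unique xC).
    by rewrite leq_mul2r (card_nbrsD1 cubic_deg).
  have yx : e y x by rewrite e_sym.
  have [ya aC] := anchorP yx xC.
  (* Of the at most two other neighbours of [y], one is its anchor, with at most one colour. In
     total at most 2 + 1 + 3 colours are forbidden. *)
  have h2 : #|side e c' y x| <= 1 + 3.
    apply: (side_card2 cubic_deg yx ya) => // [|z _ _ _]; first exact: c'1.
    by apply: leq_trans (card_colours_le _ _ _) (cubic_deg _).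
  by lia.
exists c; split=> //.
- move=> x y xC yC; case: (c3 x y) => [->|].
    by rewrite /b /blank (negPf xC) (negPf yC).
  by rewrite !sE (negPf xC) (negPf yC) /=; case.
- move=> x y xy xC yC; case: (anchor y =P x) => [E|/eqP ne]; last first.
    by apply: negbTE; apply: c4; rewrite sE xC yC xy.
  case: (c3 x y) => [->|]; first by rewrite /b /blank xC eqxx.
  by rewrite !sE (negPf yC) E eqxx !andbF /=; case.
- move=> x y xC yC; case: (c3 x y) => [->|]; first by rewrite /b /blank xC.
  by rewrite !sE xC yC /= ?andbF; case.
Qed.

Lemma cubic_step : exists c, good e c.
Proof.
have [c [cs cst cout cpend ccyc]] := pendants_coloured.
pose A i := colours e c (u i).
have Aper i : A (i + n) = A i by rewrite /A vper.
(* The anchored edge at [u i] has colour 0, which leaves at most two other edges. *)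
have A2 i : #|A i| <= 2.
  have [eu uC] := pendP i; have ue : e (u i) (v i) by rewrite e_sym.
  have [ya aC] := anchorP ue (v_on_cycle i).
  apply: (card_colours2 cubic_deg ya); rewrite cs; apply/eqP.
  by rewrite cpend // e_sym.
have [f [fper fA f1 f2]] := cycle_list_colouring n3 Aper A2.
have fA' i : [/\ f i != ord0, f i \notin A i & f i \notin A i.+1].
  by have := fA i; rewrite !inE !negb_or => /and3P.
(* An arbitrary index of a cycle vertex; [fidx] and [vidx] show that periodicity makes the choice
   immaterial. *)
pose idx x : nat := odflt 0 (omap val [pick i : 'I_n | v i == x]).
have fidx i : f (idx (v i)) = f i.
  rewrite /idx; case: pickP => [j /eqP /= /vinj E|no].
    by rewrite -(periodic_mod fper j) E (periodic_mod fper).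
  have ni : i %% n < n by rewrite ltn_mod; lia.
  by have := no (Ordinal ni); rewrite /= (periodic_mod vper) eqxx.
have vidx i : v (idx (v i)).+1 = v i.+1.
  rewrite /idx; case: pickP => [j /eqP /= /vinj E|no].
    by rewrite -(periodic_mod vper j.+1) -addn1 -modnDml E modnDml addn1
      (periodic_mod vper).
  have ni : i %% n < n by rewrite ltn_mod; lia.
  by have := no (Ordinal ni); rewrite /= (periodic_mod vper) eqxx.
pose g x y := if [&& x \in C, y \in C & e x y] then
  (if y == v (idx x).+1 then f (idx x) else f (idx y)) else c x y.
have gS i : g (v i) (v i.+1) = f i.
  by rewrite /g !v_on_cycle vS /= vidx eqxx fidx.
have gSr i : g (v i.+1) (v i) = f i.
  by rewrite /g !v_on_cycle vSr /= vidx eq_sym (negPf (cycle_step2_neq i)) fidx.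
have edgeP x y : x \in C -> y \in C -> e x y ->
    exists i, (x, y) = (v i, v i.+1) \/ (x, y) = (v i.+1, v i).
  case/(on_cycle_shift 1)=> i; rewrite addn1 => -> yC ey.
  by case: (cycle_nbr_on ey yC) => ->; [exists i; right | exists i.+1; left].
have goff x y : ~~ ((x \in C) && (y \in C)) -> g x y = c x y.
  by rewrite /g andbA => /negPf->.
have gs : csym g.
  move=> x y; case: (boolP [&& x \in C, y \in C & e x y]) => [|no].
    by case/and3P=> xC yC /(edgeP _ _ xC yC)[i [] [-> ->]]; rewrite gS gSr.
  have no' : [&& y \in C, x \in C & e y x] = false by rewrite andbCA e_sym (negPf no).
  by rewrite /g (negPf no) no' cs.
(* The edge [p q] is within distance 2 of the cycle edge [i]. The aim is to find its colour at one
   of the outer neighbours [u i] and [u i.+1]. *)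
have near i p q : e p q -> ~~ ((p \in C) && (q \in C)) ->
    e p (v i) \/ e p (v i.+1) -> c p q != ord0 -> f i != c p q.
  move=> epq off nr cn0; have [_ fi fi1] := fA' i.
  have inA j : p = u j -> c p q \in A j by move=> E; rewrite /A -E mem_colours.
  have inA' j : q = u j -> c p q \in A j.
    by move=> E; rewrite /A -E cs mem_colours ?(e_sym q) // cs.
  suff : c p q \in A i :|: A i.+1.
    by rewrite inE => h; apply/eqP=> E; move: h; rewrite -E (negPf fi) (negPf fi1).
  rewrite inE; case: (boolP (p \in C)) off => [pC /= qC|pC _]; last first.
    by case: nr => ep; [rewrite (inA i) // | rewrite (inA i.+1) ?orbT //];
      apply: pend_eq; rewrite // e_sym.
  (* A pendant edge of nonzero colour is not the anchored one, so its outer end has another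
     neighbour on the cycle. *)
  have share j : p = v j -> exists2 m, v m != v j & u m = u j.
    move=> pj; subst p; have [qv aC] := anchorP (etrans (e_sym _ _) epq) pC.
    have ne : anchor q != v j by rewrite -cpend.
    case/on_cycleP: aC ne qv => m -> ne qv; exists m => //.
    by rewrite -(pend_eq epq qC); apply/esym/pend_eq; rewrite // e_sym.
  have [k ik] : exists k, v i = v k.+2.
    by have [k ->] := on_cycle_shift 2 (v_on_cycle i); exists k; rewrite addn2.
  have ik1 : v i.+1 = v k.+3 by rewrite -vidx ik vidx.
  have Aik : A i = A k.+2 by rewrite /A ik.
  have Aik1 : A i.+1 = A k.+3 by rewrite /A ik1.
  have cases : [\/ p = v k.+1, p = v k.+2, p = v k.+3 | p = v k.+4].
    case: nr; rewrite ?ik ?ik1 e_sym => ep.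
      by case: (cycle_nbr_on ep pC); [constructor 1 | constructor 3].
    by case: (cycle_nbr_on ep pC); [constructor 2 | constructor 4].
  have inAq j m : p = v j -> u j = u m -> c p q \in A m.
    by move=> pj jm; apply: inA'; rewrite -jm; apply: pend_eq; rewrite -?pj.
  rewrite Aik Aik1; case: cases => E.
  (* Here [p] lies one step before the edge [i], and in the last case one step after it; only a
     shared outer end makes the colour visible at [u i] or [u i.+1]. *)
  - have [m mk um] := share _ E; have [[h|h] _] := shared_pendant mk um.
      by rewrite (inAq _ _ E h).
    by rewrite (inAq _ _ E h) orbT.
  - by rewrite (inAq _ _ E erefl).
  - by rewrite (inAq _ _ E erefl) orbT.
  - have [m mk um] := share _ E; have [_ /(_ _ erefl)[h|h]] := shared_pendant mk um.
      by rewrite (inAq _ _ E h).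
    by rewrite (inAq _ _ E h) orbT.
have gst : strong e g.
  move=> x y z w xy xz zy zw.
  case: (boolP ((x \in C) && (y \in C))) => [/andP[xC yC]|xyC];
    case: (boolP ((z \in C) && (w \in C))) => [/andP[zC wC]|zwC].
  - have [i xi] := on_cycle_shift 2 xC; rewrite addn2 in xi; subst x => _.
    case: (cycle_nbr_on xy yC) => Ey; case: (cycle_nbr_on xz zC) => Ez; subst y z;
      rewrite ?eqxx // in zy.
    + rewrite gSr; case: (cycle_nbr_on zw wC) => ->; first by rewrite gSr.
      by rewrite gS.
    + rewrite gS; case: (cycle_nbr_on zw wC) => ->; first by rewrite gSr eq_sym.
      by rewrite gS eq_sym.
  - have [i Ei] := edgeP _ _ xC yC xy; rewrite [g z w]goff //.
    have -> : g x y = f i by case: Ei => -[-> ->].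
    have [/eqP->|cn0] := boolP (c z w == ord0); first by case: (fA' i).
    by move=> _; apply: near => //; rewrite ![e z _]e_sym;
      case: Ei => -[<- _]; [left | right].
  - have [i Ei] := edgeP _ _ zC wC zw; rewrite [g x y]goff // => cn0.
    have -> : g z w = f i by case: Ei => -[-> ->].
    by rewrite eq_sym; apply: near => //; case: Ei => -[<- _]; [left | right].
  - by rewrite !goff //; apply: cst.
exists g; split=> //; split=> [x y /e_cubic//|].
have gzero x y : e x y -> g x y = ord0 -> ~~ ((x \in C) && (y \in C)) /\ c x y = ord0.
  move=> xy g0; case: (boolP (_ && _)) => [/andP[xC yC]|no].
    have [i Ei] := edgeP _ _ xC yC xy; have [fi _ _] := fA' i.
    by case/eqP: fi; rewrite -g0; case: Ei => -[-> ->].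
  by rewrite goff in g0.
move=> x y z xy xz /(gzero _ _ xy)[xyC cy] /(gzero _ _ xz)[xzC cz].
have [xC|xC] := boolP (x \in C).
  by rewrite xC /= in xyC xzC; apply: (pendant_unique xC).
have [_ _ [z3 zm]] := c0_good.
have anch w : e x w -> c x w = ord0 -> w \in C -> anchor x = w.
  by move=> xw cw wC; apply/eqP; rewrite -cpend 1?cs ?cw // e_sym.
(* A vertex next to the cycle has degree at most 2 in the smaller graph, so [c0] gives it no edge of
   colour 0 there. *)
have outer w t : e x w -> w \notin C -> c x w = ord0 -> e x t -> t \in C -> False.
  move=> xw wC cw xt tC; have := z3 x w; rewrite /del xw xC wC -cout //.
  move=> /(_ isT cw) h3; have := subset_leq_card (del_nbrs e C x).
  have : nbrs (del e C) x \subset nbrs e x :\ t.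
    apply/subsetP=> r; rewrite !inE => /and3P[-> _ rC]; rewrite andbT.
    by apply: contraNneq rC => ->.
  by move/subset_leq_card; rewrite h3; have := card_nbrsD1 cubic_deg xt; lia.
have [yC|yC] := boolP (y \in C); have [zC|zC] := boolP (z \in C).
- by rewrite -(anch y) // (anch z).
- by case: (outer z y).
- by case: (outer y z).
- by apply: (zm x); rewrite /del ?xy ?xz ?xC ?yC ?zC // -cout.
Qed.

End CubicStep.

(** * The theorem *)

(** The induction counts ordered adjacent pairs, which a deletion diminishes while the vertex type
    is fixed. *)
Lemma good_colouring (V : finType) (e : rel V) :
  symmetric e -> irreflexive e -> (forall x, #|nbrs e x| <= 3) ->
  exists c, good e c.
Proof.
have [m] := ubnP #|[set p : V * V | e p.1 p.2]|.
elim: m e => // m IH e em e_sym e_irr e_deg.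
have IHdel (S : {set V}) x y : x \in S -> e x y -> exists c, good (del e S) c.
  move=> xS xy; apply: IH; last 3 first.
  - by move=> p q; rewrite /del e_sym andbA andbAC -andbA.
  - by move=> p; rewrite /del e_irr.
  - by move=> z; apply: leq_trans (subset_leq_card (del_nbrs e S z)) (e_deg z).
  rewrite -ltnS; apply: leq_trans em; rewrite ltnS.
  apply: proper_card; apply/properP; split.
    by apply/subsetP=> p; rewrite !inE => /del_sub.
  by exists (x, y); rewrite !inE ?xy // /del /= xS andbF.
have nbr1 x y : y \in nbrs e x -> e x y by rewrite inE.
case: (classic (exists x y, e x y)) => [ex|noe]; last first.
  by exists (fun _ _ => ord0); split=> //; split=> x y *; case: noe; exists x, y.
case: (classic (exists x, #|nbrs e x| = 1)) => [[x /eqP/cards1P[y ny]]|no1].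
  have [|c0 gc0] := IHdel [set x] x y (set11 x).
    by apply: nbr1; rewrite ny set11.
  exact: (degree1_step e_sym e_irr e_deg ny gc0).
case: (classic (exists x, #|nbrs e x| = 2)) => [[x /eqP/cards2P[y [z [yz ny]]]]|no2].
  have [|c0 gc0] := IHdel [set x] x y (set11 x).
    by apply: nbr1; rewrite ny set21.
  exact: (degree2_step e_sym e_irr e_deg ny yz gc0).
have cubic x y : e x y -> #|nbrs e x| = 3.
  move=> xy; have := e_deg x; have : 0 < #|nbrs e x|.
    by apply/card_gt0P; exists y; rewrite inE.
  case E: #|nbrs e x| => [|[|[|[|]]]] // _ _; first by case: no1; exists x.
  by case: no2; exists x.
have [n [v [cyc n_min]]] : exists n v,
    is_cycle e n v /\ forall m' w, is_cycle e m' w -> n <= m'.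
  apply: shortest_cycle; apply: exists_cycle => // x y xy.
  have : 0 < #|nbrs e y :\ x|.
    have := cubic y x; rewrite e_sym xy (cardsD1 x) inE e_sym xy => /(_ isT) /=.
    by move: #|_|; lia.
  by case/card_gt0P=> z; rewrite !inE => /andP[zx yz]; exists z.
have [_ _ _ vS] := cyc.
have [|c0 gc0] := IHdel (on_cycle n v) (v 0) (v 1) _ (vS 0).
  exact: (v_on_cycle cyc).
exact: (cubic_step e_sym e_irr cubic cyc n_min gc0).
Qed.

(** * From symmetric functions on pairs of vertices to colourings of edges *)

Section EdgeColouring.
Variable G : sgraph.
Implicit Types f g h : edge G.

Lemma edge_end f x : x \in val f -> exists2 y, adj x y & val f = [set x; y].
Proof.
have := valP f => /imsetP[[p q]]; rewrite inE /= => pq ->.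
rewrite in_set2 => /orP[]/eqP->; first by exists q.
by exists p; rewrite 1?adj_sym // setUC.
Qed.

Lemma edge_common f g : edge_adj f g -> exists x, x \in val f /\ x \in val g.
Proof. by case/andP=> _ /pred0Pn[x /andP[]]; exists x. Qed.

(** Symmetry makes the chosen order of the two ends immaterial; the default [ord0] is never
    reached. *)
Lemma edge_colouring (c : G -> G -> 'I_9) : csym c ->
  exists d : edge G -> 'I_9, forall f x y, adj x y -> val f = [set x; y] -> d f = c x y.
Proof.
move=> cs; pose ends f := [pick p : G * G | val f == [set p.1; p.2]].
exists (fun f => if ends f is Some p then c p.1 p.2 else ord0) => f x y xy fxy.
rewrite /ends; case: pickP => [[p q] /eqP /=|/(_ (x, y))]; last by rewrite fxy eqxx.
rewrite fxy => E; have xny : x != y by apply: contraTneq xy => ->; rewrite adj_irrefl.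
have := set21 x y; rewrite E in_set2; have := set22 x y; rewrite E in_set2.
move=> /orP[]/eqP y1 /orP[]/eqP x1; subst => //; by rewrite eqxx in xny.
Qed.

End EdgeColouring.

Theorem theorem9 (G : sgraph) (hG : subcubic G) :
  exists c : edge G -> 'I_9,
    [/\ matching [set f | c f == ord0],
        (forall (i : 'I_9) (f g : edge G), i != ord0 -> c f = i -> c g = i ->
           f != g -> @dist_ge (line_graph G) 3 f g)
      & (forall (v : G) (f : edge G), degree v <= 2 -> incident v f ->
           c f != ord0)].
Proof.
have [c [cs cst [z3 zm]]] := good_colouring (@adj_sym G) (@adj_irrefl G) hG.
have [d dE] := edge_colouring cs; exists d.
have neq x y z (f g : edge G) : val f = [set x; y] -> val g = [set x; z] ->
    f != g -> z != y.
  by move=> fE gE; apply: contra => /eqP E; apply/eqP/val_inj; rewrite fE gE E.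
split.
- move=> f g; rewrite !inE => /eqP f0 /eqP g0 fg; apply/negPn/negP=> meet.
  have [|x [/edge_end[y xy fE] /edge_end[z xz gE]]] := @edge_common _ f g.
    by rewrite /edge_adj fg.
  have := neq _ _ _ _ _ fE gE fg; rewrite (zm x z y) ?eqxx //.
    by rewrite -(dE g).
  by rewrite -(dE f).
- move=> i f g i0 fi gi fg; apply/dist_geP.
  have adjacent x : x \in val f -> x \in val g -> False.
    move=> /edge_end[y xy fE] /edge_end[z xz gE].
    (* Adjacent edges are the case [w = x] of [strong], where the second edge returns to [x]. *)
    have := cst x y z x xy xz (neq _ _ _ _ _ fE gE fg); rewrite adj_sym => /(_ xz).
    by rewrite [c z x]cs -(dE f) // -(dE g) // fi gi eqxx => /(_ i0).
  (* Walks of length 0, 1 and 2 in the line graph are to be excluded. *)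
  case=> [|h [|h' [|]]] //=; first by move=> _ E; rewrite E eqxx in fg.
    by rewrite andbT => /edge_common[x [xf xh]] E; subst h; case: (adjacent x).
  rewrite andbT => /andP[fh hg] E; subst h'; exfalso.
  have [x [xf xh]] := edge_common fh; have [y [yh yg]] := edge_common hg.
  have [z xz hE] := edge_end xh.
  move: (yh); rewrite hE in_set2 => /orP[]/eqP E; subst y; first exact: (adjacent x).
  (* Now [f], [h] and [g] are the successive edges of the walk [w], [x], [z], [t], to which [strong]
     applies. *)
  have [w xw fE] := edge_end xf; have [t zt gE] := edge_end yg.
  have fh' : f != h by case/andP: fh.
  have := cst x w z t xw xz (neq _ _ _ _ _ fE hE fh') zt.
  by rewrite -(dE f) // -(dE g) // fi gi eqxx => /(_ i0).
- move=> v f dv /edge_end[y vy fE]; rewrite (dE f v y) //.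
  by apply/eqP=> c0; move: dv; rewrite /degree -/(nbrs _ _) (z3 v y).
Qed.
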